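(* Let $a>0$, $\gamma\in\mathbb{R}$, $\alpha>0$, $\mu_0\ge\max\left\{\frac{\gamma}{\alpha},0\right\}$, $q\ge0$, $p\ge0$ and $C,F\in\mathbb{R}$. Then the (two-sided) inequality $$\frac{F}{(q+x)^{\mu}}\le\widetilde S(x,a,\gamma,\alpha,\mu)\le\frac{C}{(p+x)^{\mu}}\qquad( * )$$ holds for every $\mu>\mu_0$ and every $x>0$ if and only if $0\le p\le a^{\alpha}$, $C\ge C_p(a,\gamma,\alpha)$ and $F\le F_q(a,\gamma,\alpha)$, where $$C_p(a,\gamma,\alpha):=\sup_{x>0}e^{px}\widetilde f(x,a,\gamma,\alpha),\qquad F_q(a,\gamma,\alpha):=\inf_{x>0}e^{qx}\widetilde f(x,a,\gamma,\alpha).$$ In this case (for every $\mu>\mu_0$) both inequalities in $( * )$ are strict for all $x>0$, and if $q>0$ and $p>0$ they are also strict at $x=0$. Moreover, $0<C_p(a,\gamma,\alpha)<+\infty$ for $p\le a^{\alpha}$, and $C_p(a,\gamma,\alpha)=+\infty$ for $p>a^{\alpha}$.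
   Context: For $a>0$, $\gamma\in\mathbb{R}$, $\alpha>0$: $\widetilde f(x,a,\gamma,\alpha)=\sum_{k=0}^{\infty}(-1)^k(k+a)^{\gamma}e^{-(k+a)^{\alpha}x}$ for $x>0$, and for $\mu>\max\left\{\frac{\gamma}{\alpha},0\right\}$ and $x\ge0$, $\widetilde S(x,a,\gamma,\alpha,\mu)=\sum_{k=0}^{\infty}\frac{(-1)^k(k+a)^{\gamma}}{((k+a)^{\alpha}+x)^{\mu}}$ (generalized alternating Mathieu series; the series is understood as the limit of its partial sums, since it may converge only conditionally). *)

(* Defs.v *)
From mathcomp Require Import all_boot all_order all_algebra.
From mathcomp Require Import all_classical all_reals all_analysis.

Set Implicit Arguments.
Unset Strict Implicit.
Unset Printing Implicit Defensive.

Import Order.TTheory GRing.Theory Num.Theory.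
Import numFieldNormedType.Exports.

Local Open Scope classical_set_scope.
Local Open Scope ring_scope.

Definition ftilde (R : realType) (x a gamma alpha : R) : R :=
  limn (series (fun k : nat =>
    (-1) ^+ k * (k%:R + a) `^ gamma * expR (- ((k%:R + a) `^ alpha * x)))).

(* The generalized alternating Mathieu series.  It may converge only
   conditionally, so the sum is the limit of the sequence of partial sums. *)
Definition Stilde (R : realType) (x a gamma alpha mu : R) : R :=
  limn (series (fun k : nat =>
    (-1) ^+ k * (k%:R + a) `^ gamma / ((k%:R + a) `^ alpha + x) `^ mu)).

(* The supremum and infimum are taken in the extended reals, since the
   supremum may be infinite. *)
Definition Csup (R : realType) (p a gamma alpha : R) : \bar R :=
  ereal_sup [set (expR (p * x) * ftilde x a gamma alpha)%:E
            | x in [set x : R | 0 < x]].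

Definition Finf (R : realType) (q a gamma alpha : R) : \bar R :=
  ereal_inf [set (expR (q * x) * ftilde x a gamma alpha)%:E
            | x in [set x : R | 0 < x]].

(* Main.v *)
Require Import Defs.
From mathcomp Require Import all_boot all_order all_algebra.
From mathcomp Require Import all_classical all_reals all_analysis.
From mathcomp Require Import measurable_realfun.
From mathcomp Require Import ring lra.

(* Write f for ftilde and S for Stilde, and lam_k = (k + a) ^ alpha.  Since
     1 / (lam + x) ^ mu = (1 / Gamma mu) * int_0^oo t ^ (mu - 1) e^{-(lam + x) t} dt,
   S is a positive average of f: Gamma mu * S x = int t ^ (mu - 1) e^{-x t} f t dt,
   so that pointwise bounds F e^{-q t} <= f t <= C e^{-p t} integrate to the
   bounds on S.  They are strict because f, as a Dirichlet series with at least
   two terms, differs from every exponential near +oo.  Interchanging sum and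
   integral only needs |f_n t| <= K t ^ (- max (gamma / alpha) 0) e^{-c t} for
   the partial sums f_n, which holds because the terms of the alternating sum
   are unimodal in k.
   Conversely, taking x = mu / t and letting mu tend to +oo, the Post-Widder
   formula x ^ mu * S x --> f t turns the bounds on S back into bounds on f.
   Finally e ^ (a ^ alpha t) f t --> a ^ gamma at +oo decides when the supremum
   is finite, once f is known to be bounded near 0: an m-fold Euler transform
   replaces the terms by their m-th differences, which are
   O((k + a) ^ (gamma - m)) uniformly in t. *)

Import Order.TTheory GRing.Theory Num.Theory.
Import numFieldNormedType.Exports.

Local Open Scope classical_set_scope.
Local Open Scope ring_scope.

(** * Elementary bounds and a telescoping majorant *)

Lemma powR_expR_le (R : realType) (s y : R) : 0 <= s -> 0 < y ->
  y `^ s * expR (- y) <= s `^ s.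
Proof.
rewrite le_eqVlt => /predU1P[<-|s0] y0.
  by rewrite !powRr0 mul1r -expR0 ler_expR oppr_le0 ltW.
have z0 : 0 < y / s by rewrite divr_gt0.
rewrite /powR !gt_eqF// -expRD ler_expR lerBlDr.
have -> : ln y = ln (y / s) + ln s by rewrite ln_div ?posrE// subrK.
rewrite mulrDr [leRHS]addrC lerD2r.
(* [y ^ s * e^{-y}] is largest at [y = s]; the tangent of [ln] at 1, taken at [y / s], proves it. *)
have h : ln (y / s) <= y / s - 1.
  by rewrite -[in leLHS](subrK 1 (y / s)) [_ + 1]addrC le_ln1Dx// ltrBrDl subrr.
rewrite -(ler_pM2l s0) in h; apply: (le_trans h).
by rewrite mulrBr mulrCA divff ?gt_eqF// !mulr1 gerBl ltW.
Qed.

(** The common majorant for all series comparisons: it decays like [k ^ -2], and its partial sums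
    telescope, so convergence and the bound 1 are explicit. *)
Definition oblong_inv (R : realType) (k : nat) : R := (k.+1 * k.+2)%:R^-1.

Lemma oblong_inv_ge0 (R : realType) k : 0 <= oblong_inv R k.
Proof. by rewrite invr_ge0. Qed.

Lemma series_oblong_inv (R : realType) n :
  series (oblong_inv R) n = 1 - n.+1%:R^-1.
Proof.
rewrite /series /=.
elim: n => [|n IH]; first by rewrite big_nil invr1 subrr.
rewrite big_nat_recr//= IH /oblong_inv natrM -!(natr1 n.+1) -(natr1 n).
have : (0 : R) <= n%:R by []. move: (n%:R) => x x0.
field; apply/andP; split; apply: lt0r_neq0; lra.
Qed.

Lemma series_oblong_inv_le1 (R : realType) n : series (oblong_inv R) n <= 1.
Proof. by rewrite series_oblong_inv gerBl invr_ge0. Qed.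

Lemma is_cvg_series_oblong_inv (R : realType) : cvgn (series (oblong_inv R)).
Proof.
apply: nondecreasing_is_cvgn.
  by apply/nondecreasing_series => k _ _; exact: oblong_inv_ge0.
by exists 1 => _ [n _ <-]; exact: series_oblong_inv_le1.
Qed.

(** With [c = min a 1] one has [k + a >= c * (k + 1)]; the factor 2 comes from
    [k + 2 <= 2 * (k + 1)]. *)
Lemma powR_le_oblong_inv (R : realType) (a s : R) : 0 < a -> s <= -2 ->
  exists2 K, 0 <= K & forall k : nat, (k%:R + a) `^ s <= K * oblong_inv R k.
Proof.
move=> a0 s2; pose c := Num.min a 1.
have c0 : 0 < c by rewrite lt_min a0/=.
exists (2 * c `^ s); first by rewrite mulr_ge0// powR_ge0.
move=> k.
have ck : c * k.+1%:R <= k%:R + a.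
  rewrite -natr1 mulrDr mulr1 lerD//; last by rewrite ge_min lexx.
  by rewrite ler_piMl// ge_min lexx orbT.
have ck0 : 0 < c * k.+1%:R by rewrite mulr_gt0.
have ka0 : 0 < k%:R + a by apply: lt_le_trans ck.
have -> : s = - (- s) by rewrite opprK.
rewrite (powRN (k%:R + a)) (powRN c).
have h : (c * k.+1%:R) `^ (- s) <= (k%:R + a) `^ (- s).
  by apply: ge0_ler_powR => //; rewrite ?nnegrE ?ltW//; lra.
apply: (@le_trans _ _ ((c * k.+1%:R) `^ (- s))^-1).
  by rewrite lef_pV2// posrE powR_gt0.
rewrite powRM ?(ltW c0)// invfM [2 * _]mulrC -mulrA ler_pM2l ?invr_gt0 ?powR_gt0//.
apply: (@le_trans _ _ (k.+1%:R ^+ 2)^-1).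
  rewrite lef_pV2 ?posrE ?powR_gt0 ?exprn_gt0// -powR_mulrn//.
  by apply: ler_powR; [rewrite ler1n|lra].
have -> : oblong_inv R k = k.+1%:R^-1 * k.+2%:R^-1.
  by rewrite /oblong_inv natrM invfM.
rewrite mulrCA expr2 invfM ler_pM2l ?invr_gt0//.
rewrite ler_pdivlMr// mulrC ler_pdivrMr//.
by rewrite -!natr1; have : (0 : R) <= k%:R by []; lra.
Qed.

(** * Dominated convergence for series *)

Lemma dominated_series_cvg (R : realType) (u M : R^nat) :
  (forall k, `|u k| <= M k) -> cvgn (series M) -> cvgn (series u).
Proof.
move=> uM cM; apply: normed_cvg; apply: (series_le_cvg _ _ _ cM) => k //=.
by apply: le_trans (uM k).
Qed.

(** Domination is asked only from [N] on, so that the majorant may be adapted to the tail. *)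
Lemma series_tail_le (R : realType) (u M : R^nat) (N : nat) :
  (forall k, (N <= k)%N -> `|u k| <= M k) ->
  cvgn (series u) -> cvgn (series M) ->
  `|limn (series u) - series u N| <= limn (series M) - series M N.
Proof.
move=> uM cu cM.
have h n : (N <= n)%N -> `|series u n - series u N| <= series M n - series M N.
  move=> Nn; rewrite !sub_series_geq//.
  apply: (le_trans (ler_norm_sum _ _ _)).
  by apply: ler_sum_nat => k /andP[Nk _]; exact: uM.
apply: (@ler_cvg_to _ eventually _ R (fun n => `|series u n - series u N|)
  (fun n => series M n - series M N)).
- by apply: cvg_norm; apply: cvgB => //; exact: cvg_cst.
- by apply: cvgB => //; exact: cvg_cst.
- by exists N => // n /= Nn; exact: h.
Qed.

(** Dominated convergence for sums; it lets the Post-Widder limit be taken term by term. *)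
Lemma tannery (R : realType) (u : nat -> R^nat) (v M : R^nat) :
  (forall j k, `|u j k| <= M k) -> cvgn (series M) ->
  (forall k, u j k @[j --> \oo] --> v k) ->
  limn (series (u j)) @[j --> \oo] --> limn (series v).
Proof.
move=> uM cM uv.
have vM k : `|v k| <= M k.
  apply: (@ler_cvg_to _ eventually _ R (fun j => `|u j k|) (fun=> M k)).
  - by apply: cvg_norm; exact: uv.
  - exact: cvg_cst.
  - by exists 0%N => // j _; exact: uM.
have cS N : series (u j) N @[j --> \oo] --> series v N.
  rewrite /series /=; elim: N => [|N IH].
    rewrite big_nil; under eq_fun do rewrite big_nil; exact: cvg_cst.
  rewrite big_nat_recr//=; under eq_fun do rewrite big_nat_recr//=.
  exact: cvgD.
apply/cvgrPdist_lt => e e0.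
have e4 : 0 < e / 4 by rewrite divr_gt0.
(* Three errors below [e / 4] suffice: the two tails past [N], both controlled by the tail of [M],
   and the difference of the first [N] terms. *)
have /cvgrPdist_lt /(_ _ e4) [N _ /(_ N (leqnn N)) hN] := cM.
have tM : limn (series M) - series M N < e / 4.
  by apply: le_lt_trans hN; exact: ler_norm.
have /cvgrPdist_lt /(_ _ e4) [j0 _ hj] := cS N.
exists j0 => // j /= j0j.
have cv := dominated_series_cvg R _ _ vM cM.
have cu := dominated_series_cvg R _ _ (uM j) cM.
have hv := @series_tail_le R v M N (fun k _ => vM k) cv cM.
have hu := @series_tail_le R (u j) M N (fun k _ => uM j k) cu cM.
have := hj j j0j.
have -> : limn (series v) - limn (series (u j)) =
  (limn (series v) - series v N) + ((series v N - series (u j) N) -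
   (limn (series (u j)) - series (u j) N)) by lra.
move=> h; apply: (le_lt_trans (ler_normD _ _)).
have := ler_normB (series v N - series (u j) N) (limn (series (u j)) - series (u j) N).
lra.
Qed.

(** * Alternating sums of unimodal sequences *)

Lemma alternating_sum_diff (R : realType) (g : R^nat) n :
  \sum_(0 <= k < n) (-1) ^+ k * (g k + g k.+1) = g 0%N - (-1) ^+ n * g n.
Proof.
elim: n => [|n IH]; first by rewrite big_nil expr0 mul1r subrr.
by rewrite big_nat_recr//= IH exprS; ring.
Qed.

(* The second hypothesis says that [g] decreases forever once it stops
   increasing. *)
Lemma unimodal_variation (R : realType) (g : R^nat) (B : R) :
  (forall k, 0 <= g k <= B) ->
  (forall k, g k.+1 <= g k -> g k.+2 <= g k.+1) ->
  forall n, \sum_(0 <= k < n) `|g k.+1 - g k| <= 2 * B.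
Proof.
move=> gB ug n.
(* Invariant with two phases: during the ascent the variation telescopes to at most [g n]; past the
   peak, each descent is paid for by the decrease of [g n] in [2 * B - g n]. *)
suff: \sum_(0 <= k < n) `|g k.+1 - g k| <= g n \/
      (\sum_(0 <= k < n) `|g k.+1 - g k| <= 2 * B - g n /\ g n.+1 <= g n).
  by move: (gB n) => /andP[? ?] [?|[? _]]; lra.
elim: n => [|n IH]; first by left; rewrite big_nil; case/andP: (gB 0%N).
rewrite big_nat_recr//=; have /andP[_ gn] := gB n.
case: IH => [h|[h gSn]].
  have [le|lt] := lerP (g n.+1) (g n).
    by right; split; [lra|exact: ug].
  by left; lra.
by right; rewrite ler0_norm ?subr_le0//; split; [lra|exact: ug].
Qed.

(** Twice the sum is a boundary term minus the alternating sum of the increments; each is at most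
    [2 * B], the latter because the total variation is. *)
Lemma unimodal_alternating_sum (R : realType) (g : R^nat) (B : R) :
  (forall k, 0 <= g k <= B) ->
  (forall k, g k.+1 <= g k -> g k.+2 <= g k.+1) ->
  forall n, `|\sum_(0 <= k < n) (-1) ^+ k * g k| <= 2 * B.
Proof.
move=> gB ug n.
have e : 2 * \sum_(0 <= k < n) (-1) ^+ k * g k =
    (g 0%N - (-1) ^+ n * g n) - \sum_(0 <= k < n) (-1) ^+ k * (g k.+1 - g k).
  rewrite -alternating_sum_diff -sumrB mulr_sumr.
  by apply: eq_bigr => k _; ring.
have h1 : `|\sum_(0 <= k < n) (-1) ^+ k * (g k.+1 - g k)| <= 2 * B.
  apply: le_trans (unimodal_variation _ _ _ gB ug n).
  apply: (le_trans (ler_norm_sum _ _ _)); apply: ler_sum => k _.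
  by rewrite normrM normrX normrN1 expr1n mul1r.
have h2 : `|g 0%N - (-1) ^+ n * g n| <= 2 * B.
  apply: (le_trans (ler_normB _ _)).
  rewrite normrM normrX normrN1 expr1n mul1r.
  move: (gB 0%N) (gB n) => /andP[? ?] /andP[? ?].
  by rewrite !ger0_norm//; lra.
rewrite -(ler_pM2l (ltr0n _ 2 : 0 < 2)) -[X in X * `|_|](@ger0_norm _ 2)// -normrM e.
by apply: (le_trans (ler_normB _ _)); lra.
Qed.

(** * Euler transform and iterated differences *)

Definition fdiff (R : realType) (g : R -> R) (u : R) : R := g (u + 1) - g u.

(** Summation by parts, iterated [m] times: each pass gains a factor [- 1 / 2], replaces the summand
    by its difference, and leaves boundary terms at [a] and at [n + a]. *)
Lemma euler_transform (R : realType) (a : R) (g : R -> R) (m n : nat) :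
  \sum_(0 <= k < n) (-1) ^+ k * g (k%:R + a) =
  \sum_(0 <= i < m) (-2^-1) ^+ i * 2^-1 *
    (iter i (@fdiff R) g a - (-1) ^+ n * iter i (@fdiff R) g (n%:R + a)) +
  (-2^-1) ^+ m * \sum_(0 <= k < n) (-1) ^+ k * iter m (@fdiff R) g (k%:R + a).
Proof.
elim: m => [|m IH]; first by rewrite big_nil expr0 mul1r add0r.
rewrite IH big_nat_recr//= -addrA; congr (_ + _).
set G := iter m _ g; rewrite exprSr -!mulrA -mulrDr; congr (_ * _).
have := alternating_sum_diff _ (fun k => G (k%:R + a)) n.
rewrite /= add0r => e.
have -> : G a - (-1) ^+ n * G (n%:R + a) =
  2 * (\sum_(0 <= k < n) (-1) ^+ k * G (k%:R + a)) +
  \sum_(0 <= k < n) (-1) ^+ k * fdiff R G (k%:R + a).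
  rewrite -e mulr_sumr -big_split/=; apply: eq_bigr => k _.
  by rewrite /fdiff -natr1 [k%:R + a + 1]addrAC; ring.
by field.
Qed.

Lemma iter_fdiff_mvt (R : realType) (a : R) (D : nat -> R -> R) (m : nat) :
  (forall i u, a <= u -> is_derive u 1 (D i) (D i.+1 u)) ->
  forall u, a <= u ->
  exists2 xi, u <= xi <= u + m%:R & iter m (@fdiff R) (D 0%N) u = D m xi.
Proof.
elim: m D => [|m IH] D dD u au; first by exists u; rewrite ?addr0 ?lexx.
have dfD i v : a <= v -> is_derive v 1 (fdiff R (D i)) (fdiff R (D i.+1) v).
  move=> av; apply: is_deriveB; last exact: dD.
  have dS : is_derive (v + 1) 1 (D i) (D i.+1 (v + 1)) by apply: dD; lra.
  have ds := @is_derive_shift R v 1 1.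
  have := @is_derive1_comp R (D i) (shift 1) v _ _ dS ds.
  by rewrite mulr1.
(* The differences [fdiff (D i)] again form a chain of successive derivatives, so the induction
   hypothesis handles [m] differences and one more mean value theorem handles the last. *)
have [xi /andP[uxi xium]] := IH (fun i => fdiff R (D i)) dfD u au.
rewrite /= -iterSr /= => ->.
have axi : a <= xi by lra.
have [|||c] := @MVT_segment R (D m) (D m.+1) xi (xi + 1).
- by rewrite lerDl.
- by move=> x; rewrite in_itv/= => /andP[? _]; apply: dD; lra.
- apply: derivable_within_continuous => x; rewrite in_itv/= => /andP[? _].
  by apply: ex_derive; apply: dD; lra.
rewrite in_itv/= => /andP[xic cxi] h.
exists c; first by rewrite -natr1; lra.
by rewrite /fdiff h; ring.
Qed.

(* The i-th derivative of [u ^ gamma * e^{-t u ^ alpha}] is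
   [P_i(t u ^ alpha) * u ^ (gamma - i) * e^{-t u ^ alpha}]; the recursion comes
   from differentiating this form. *)
Fixpoint tower_poly (R : realType) (gamma alpha : R) (i : nat) : {poly R} :=
  if i is j.+1 then
    let P := tower_poly R gamma alpha j in
    alpha *: ('X * P^`()) + (gamma - j%:R) *: P - alpha *: ('X * P)
  else 1.

Definition tower (R : realType) (gamma alpha t : R) (i : nat) (u : R) : R :=
  (tower_poly R gamma alpha i).[u `^ alpha * t] * u `^ (gamma - i%:R) *
  expR (- (u `^ alpha * t)).

Lemma is_derive_tower (R : realType) (gamma alpha t : R) i (u : R) : 0 < u ->
  is_derive u 1 (tower R gamma alpha t i) (tower R gamma alpha t i.+1 u).
Proof.
move=> u0; rewrite /tower /=; set P := tower_poly _ _ _ i.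
have pB1 s : u `^ (s - 1) = u `^ s / u.
  by rewrite powRD ?powR_inv1 ?(ltW u0)// (gt_eqF u0) implybT.
have dy : is_derive u 1 (fun v : R => v `^ alpha * t) (alpha * u `^ alpha / u * t).
  have := is_deriveM (is_derive1_powR alpha u0) (is_derive_cst t u 1).
  move=> /is_derive_eq; apply.
  rewrite scaler0 add0r pB1.
  by rewrite /cst /GRing.scale/=; ring.
have dP := @is_derive1_comp R (horner P) _ u _ _ (is_derive_poly P _) dy.
have dn : is_derive u 1 (fun v : R => - (v `^ alpha * t)) (- (alpha * u `^ alpha / u * t)).
  exact: is_deriveN.
have dE := @is_derive1_comp R expR _ u _ _ (is_derive_expR _) dn.
have dp := is_derive1_powR (gamma - i%:R) u0.
have := is_deriveM (is_deriveM dP dp) dE.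
move=> /is_derive_eq; apply.
rewrite /= !hornerE /GRing.scale/= -natr1 opprD addrA.
rewrite !pB1.
rewrite !fctE /= /P.
field; exact: lt0r_neq0.
Qed.

Lemma is_cvg_series_oblong_invZ (R : realType) (K : R) :
  cvgn (series (fun k => K * oblong_inv R k)).
Proof.
rewrite (_ : series _ = (fun n => K * series (oblong_inv R) n)).
  by apply: is_cvgMr; exact: is_cvg_series_oblong_inv.
by apply/funext => n; rewrite /series /= mulr_sumr.
Qed.

Lemma tower0 (R : realType) (gamma alpha t u : R) :
  tower R gamma alpha t 0 u = u `^ gamma * expR (- (u `^ alpha * t)).
Proof. by rewrite /tower /= hornerC mul1r subr0. Qed.

Lemma poly_expR_bounded (R : realType) (P : {poly R}) :
  exists2 K, 0 <= K & forall y : R, 0 < y -> `|P.[y] * expR (- y)| <= K.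
Proof.
(* Strengthened to all weights [y ^ j], because splitting [P * X + c] raises the power of [y] by
   one. *)
suff [K K0 hK] : exists2 K : nat -> R, (forall j, 0 <= K j) &
    forall j y, 0 < y -> `|P.[y] * y ^+ j * expR (- y)| <= K j.
  by exists (K 0%N) => // y y0; move: (hK 0%N y y0); rewrite expr0 mulr1.
elim/poly_ind: P => [|P c [K K0 hK]].
  by exists (fun=> 0) => // j y _; rewrite horner0 !mul0r normr0.
exists (fun j => K j.+1 + `|c| * j%:R `^ j%:R) => [j|j y y0].
  by rewrite addr_ge0// mulr_ge0// powR_ge0.
rewrite !hornerE.
have -> : (P.[y] * y + c) * y ^+ j * expR (- y) =
  P.[y] * y ^+ j.+1 * expR (- y) + c * (y ^+ j * expR (- y)).
  by rewrite exprS; ring.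
apply: (le_trans (ler_normD _ _)); apply: lerD; first exact: hK.
rewrite normrM ler_wpM2l// ger0_norm ?mulr_ge0 ?exprn_ge0 ?expR_ge0 ?(ltW y0)//.
by rewrite -powR_mulrn ?(ltW y0)//; exact: powR_expR_le.
Qed.

(** The constant is uniform in [t]: apart from the power of [u], everything depends only on
    [y = u ^ alpha * t], and [P(y) * e^{-y}] is bounded on [y > 0]. *)
Lemma tower_bound (R : realType) (gamma alpha : R) (i : nat) :
  exists2 K, 0 <= K & forall t u : R, 0 < t -> 0 < u ->
    `|tower R gamma alpha t i u| <= K * u `^ (gamma - i%:R).
Proof.
have [K K0 hK] := poly_expR_bounded R (tower_poly R gamma alpha i).
exists K => // t u t0 u0; rewrite /tower mulrAC normrM.
rewrite [X in _ * X]ger0_norm ?powR_ge0// ler_wpM2r ?powR_ge0//.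
by apply: hK; rewrite mulr_gt0// powR_gt0.
Qed.

(** Adding both endpoint values covers increasing and decreasing powers at once. *)
Lemma powR_between (R : realType) (a b s u : R) : 0 < a -> a <= u <= b ->
  u `^ s <= a `^ s + b `^ s.
Proof.
move=> a0 /andP[au ub]; have u0 := lt_le_trans a0 au.
have b0 := lt_le_trans u0 ub.
have [s0|s0] := leP 0 s.
  rewrite -[leLHS]add0r lerD ?powR_ge0//.
  by apply: ge0_ler_powR => //; rewrite nnegrE ltW.
rewrite -[leLHS]addr0 lerD ?powR_ge0//.
rewrite -(opprK s) !(powRN _ (- s)) lef_pV2 ?posrE ?powR_gt0//.
by apply: ge0_ler_powR; rewrite ?nnegrE ?(ltW u0) ?(ltW a0)// oppr_ge0 ltW.
Qed.

Lemma cvg_iter_fdiff (R : realType) (a : R) (g : R -> R) (i : nat) :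
  g (n%:R + a) @[n --> \oo] --> 0 ->
  iter i (fdiff R) g (n%:R + a) @[n --> \oo] --> 0.
Proof.
elim: i => [//|i IH] /IH /=; set G := iter i _ g => G0.
rewrite -(subrr 0); apply: cvgB => //.
under eq_fun do rewrite addrAC natr1.
by move: G0; rewrite -(cvg_shiftS (fun n => G (n%:R + a))).
Qed.

(** * Convergence and uniform boundedness of f *)

Section ftilde_theory.
Context (R : realType) (a gamma alpha : R) (a0 : 0 < a) (alpha0 : 0 < alpha).

Lemma base_gt0 (k : nat) : 0 < k%:R + a.
Proof. by rewrite ltr_wpDl. Qed.

Lemma exp_term_le (t : R) : 0 < t -> exists2 K, 0 <= K & forall k : nat,
  (k%:R + a) `^ gamma * expR (- ((k%:R + a) `^ alpha * t))
    <= K * oblong_inv R k.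
Proof.
(* [s] is chosen so that trading the exponential for [(u ^ alpha * t) ^ (- s)] brings the exponent
   of [u] down to at most -2. *)
move=> t0; pose s := Num.max ((gamma + 2) / alpha) 0.
have s0 : 0 <= s by rewrite le_max lexx orbT.
have sl : gamma - alpha * s <= -2.
  have : (gamma + 2) / alpha <= s by rewrite le_max lexx.
  by rewrite ler_pdivrMr// mulrC; lra.
have [K K0 hK] := powR_le_oblong_inv R a _ a0 sl.
exists (s `^ s * t `^ (- s) * K); first by rewrite !mulr_ge0 ?powR_ge0.
move=> k; have b0 := base_gt0 k; set u := k%:R + a in b0 *.
have y0 : 0 < u `^ alpha * t by rewrite mulr_gt0// powR_gt0.
have h := powR_expR_le R s _ s0 y0.
have -> : expR (- (u `^ alpha * t)) =
    t `^ (- s) * u `^ (- (alpha * s)) *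
    ((u `^ alpha * t) `^ s * expR (- (u `^ alpha * t))).
  rewrite powRM ?powR_ge0 ?(ltW t0)// -powRrM !powRN mulrA.
  by field; rewrite !lt0r_neq0 ?powR_gt0.
have -> (E : R) : u `^ gamma * (t `^ (- s) * u `^ (- (alpha * s)) * E) =
    t `^ (- s) * u `^ (gamma - alpha * s) * E.
  by rewrite powRD ?(gt_eqF b0) ?implybT//; ring.
apply: (@le_trans _ _ (t `^ (- s) * u `^ (gamma - alpha * s) * s `^ s)).
  by rewrite ler_wpM2l// mulr_ge0 ?powR_ge0.
rewrite [leRHS](_ : _ = t `^ (- s) * (K * oblong_inv R k) * s `^ s); last ring.
by rewrite ler_wpM2r ?powR_ge0// ler_wpM2l ?powR_ge0// hK.
Qed.

Lemma norm_alternate (k : nat) (x : R) : 0 <= x -> `|(-1) ^+ k * x| = x.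
Proof. by move=> x0; rewrite normrM normrX normrN1 expr1n mul1r ger0_norm. Qed.

Lemma is_cvg_ftilde (t : R) : 0 < t -> cvgn (series (fun k : nat =>
  (-1) ^+ k * (k%:R + a) `^ gamma * expR (- ((k%:R + a) `^ alpha * t)))).
Proof.
move=> t0; have [L L0 hL] := exp_term_le t t0.
apply: (dominated_series_cvg R _ (fun k => L * oblong_inv R k)).
  move=> k; rewrite -mulrA norm_alternate ?hL//.
  by rewrite mulr_ge0 ?powR_ge0 ?expR_ge0.
exact: is_cvg_series_oblong_invZ.
Qed.

(** The termwise bound blows up as [t] tends to 0. After [m] Euler steps the remaining sum is
    dominated uniformly in [t], and so are the boundary terms at [a]. *)
Lemma ftilde_bounded : exists B : R, forall t : R, 0 < t -> `|ftilde t a gamma alpha| <= B.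
Proof.
pose m := (Num.truncn (`|gamma| + 2)).+1.
have mg : gamma - m%:R <= -2.
  have : `|gamma| + 2 < m%:R by rewrite Num.Theory.truncnS_gt.
  by have := ler_norm gamma; lra.
have [C C0 hC] := powR_le_oblong_inv R a _ a0 mg.
have /choice[K hK] : forall i, exists K, 0 <= K /\ forall t u : R, 0 < t -> 0 < u ->
    `|tower R gamma alpha t i u| <= K * u `^ (gamma - i%:R).
  by move=> i; have [K ? ?] := tower_bound R gamma alpha i; exists K.
(* Bounds the [i]-th difference at [a], whose mean value point lies in [[a, a + i]]. *)
pose E i := K i * (a `^ (gamma - i%:R) + (a + i%:R) `^ (gamma - i%:R)).
exists (\sum_(0 <= i < m) E i + K m * C) => t t0.
pose g := tower R gamma alpha t 0.
have gE (k : nat) : (-1) ^+ k * (k%:R + a) `^ gamma *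
    expR (- ((k%:R + a) `^ alpha * t)) = (-1) ^+ k * g (k%:R + a).
  by rewrite /g tower0 mulrA.
have mvt i u : a <= u -> exists2 xi, u <= xi <= u + i%:R &
    iter i (fdiff R) g u = tower R gamma alpha t i xi.
  move=> au; apply: iter_fdiff_mvt au => j v av.
  by apply: is_derive_tower; exact: lt_le_trans av.
have g0 : g (n%:R + a) @[n --> \oo] --> 0.
  have [L L0 hL] := exp_term_le t t0.
  have c0 : (fun n => L * oblong_inv R n) @ \oo --> 0.
    rewrite -[0](mulr0 L); apply: cvgMr.
    exact/cvg_series_cvg_0/is_cvg_series_oblong_inv.
  have sq : \forall n \near \oo, 0 <= g (n%:R + a) <= L * oblong_inv R n.
    exists 0%N => // n _; rewrite /g tower0 hL andbT.
    by rewrite mulr_ge0 ?powR_ge0 ?expR_ge0.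
  exact: (squeeze_cvgr sq (cvg_cst 0) c0).
rewrite /ftilde; under eq_fun do rewrite gE.
set S := series _.
have SE n : `|S n| <= \sum_(0 <= i < m) (E i + `|iter i (fdiff R) g (n%:R + a)|) +
    K m * C.
  rewrite /S /series /= (euler_transform R a g m n).
  apply: (le_trans (ler_normD _ _)); apply: lerD.
    apply: (le_trans (ler_norm_sum _ _ _)); apply: ler_sum => i _.
    rewrite !normrM normrX normrN ger0_norm// -exprSr.
    rewrite -[leRHS]mul1r ler_pM//; first by rewrite exprn_ile1// invf_le1// ler1n.
    apply: (le_trans (ler_normB _ _)).
    rewrite normrM normrX normrN1 expr1n mul1r lerD2r.
    have [xi /andP[axi xia] ->] := mvt i a (lexx a).
    have [Ki0 hKi] := hK i.
    apply: (le_trans (hKi t xi t0 (lt_le_trans a0 axi))).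
    by rewrite ler_wpM2l// powR_between// axi.
  rewrite normrM normrX normrN [X in X ^+ m]ger0_norm//.
  rewrite -[leRHS]mul1r ler_pM//; first by rewrite exprn_ile1// invf_le1// ler1n.
  apply: (le_trans (ler_norm_sum _ _ _)).
  have [Km0 hKm] := hK m.
  apply: (@le_trans _ _ (\sum_(0 <= k < n) K m * C * oblong_inv R k)).
    apply: ler_sum => k _; rewrite normrM normrX normrN1 expr1n mul1r.
    have ak : a <= k%:R + a by rewrite lerDr.
    have [xi /andP[axi xia] ->] := mvt m _ ak.
    apply: (le_trans (hKm t xi t0 _)); first by have := base_gt0 k; lra.
    rewrite -mulrA ler_wpM2l//; apply: le_trans (hC k).
    have [b0 xi0] : 0 < k%:R + a /\ 0 < xi by have := base_gt0 k; lra.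
    have nn : 0 <= m%:R - gamma by lra.
    rewrite -[gamma - _]opprB !(powRN _ (m%:R - gamma)) lef_pV2 ?posrE ?powR_gt0//.
    by apply: ge0_ler_powR; rewrite ?nnegrE ?(ltW xi0) ?(ltW b0).
  rewrite -mulr_sumr -[leRHS]mulr1 ler_wpM2l ?mulr_ge0//.
  exact: series_oblong_inv_le1.
have cS : cvgn S by have := is_cvg_ftilde t t0; under eq_fun do rewrite gE.
(* As [n] tends to infinity the boundary differences at [n + a] vanish, and what is left does not
   depend on [t]. *)
apply: (@ler_cvg_to _ eventually _ R (fun n => `|S n|) _ _ _ (cvg_norm cS)); last first.
  by exists 0%N => // n _; exact: SE.
apply: cvgD; last exact: cvg_cst.
elim: m {mg hC SE} => [|m IH].
  by rewrite big_nil; under eq_fun do rewrite big_nil; exact: cvg_cst.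
rewrite big_nat_recr//=; under eq_fun do rewrite big_nat_recr//=.
have d0 : `|iter m (fdiff R) g (n%:R + a)| @[n --> \oo] --> 0.
  by rewrite -(normr0 R); apply: cvg_norm; exact: cvg_iter_fdiff.
have c0 : cst (E m) n @[n --> \oo] --> E m by exact: cvg_cst.
have c1 : E m + `|iter m (fdiff R) g (n%:R + a)| @[n --> \oo] --> E m + 0.
  exact: cvgD.
by rewrite addr0 in c1; apply: cvgD.
Qed.

End ftilde_theory.

(** * A uniform bound on the partial sums of f *)

Section ftilde_estimates.
Context (R : realType) (a gamma alpha : R) (a0 : 0 < a) (alpha0 : 0 < alpha).

Lemma freq_gt0 (k : nat) : 0 < (k%:R + a) `^ alpha.
Proof. by rewrite powR_gt0// base_gt0. Qed.

Lemma freq_lt (k l : nat) : (k < l)%N -> (k%:R + a) `^ alpha < (l%:R + a) `^ alpha.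
Proof.
move=> kl; apply: gt0_ltr_powR; rewrite ?nnegrE ?ltrD2r ?ltr_nat//.
  by rewrite ltW// base_gt0.
by rewrite ltW// base_gt0.
Qed.

Lemma freq_le (k l : nat) : (k <= l)%N -> (k%:R + a) `^ alpha <= (l%:R + a) `^ alpha.
Proof. by rewrite leq_eqVlt => /predU1P[->//|/freq_lt/ltW]. Qed.

(** For [e < 0] the function [e ln w - t w] is decreasing. For [e >= 0] it is concave: a descent
    from [v] to [w] forces [e <= t * w], that is a nonpositive slope at [w], and the descent
    continues. *)
Lemma unimodal_lnB (e t v w z : R) : 0 < t -> 0 < v -> v < w -> w < z ->
  e * ln w - t * w <= e * ln v - t * v -> e * ln z - t * z <= e * ln w - t * w.
Proof.
move=> t0 v0 vw wz h.
have w0 : 0 < w by lra.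
have z0 : 0 < z by lra.
have [e0|e0] := lerP 0 e; last first.
  have : ln w <= ln z by rewrite ler_ln ?posrE ?ltW.
  rewrite -(ler_nM2l e0); have : t * w <= t * z by rewrite ler_pM2l// ltW.
  lra.
have ln_le (x y : R) : 0 < x -> 0 < y -> ln y - ln x <= (y - x) / x.
  move=> x0 y0; rewrite -ln_div ?posrE//.
  have -> : y / x = 1 + (y - x) / x by field; exact: lt0r_neq0.
  apply: le_ln1Dx.
  rewrite mulrBl divff ?lt0r_neq0// ltrBrDr addrC subrr.
  by rewrite divr_gt0.
have ew : e <= t * w.
  have h1 := ln_le w v w0 v0.
  have h2 : e * ((w - v) / w) <= t * (w - v).
    apply: (@le_trans _ _ (e * (ln w - ln v))); last by lra.
    rewrite ler_wpM2l//.
    have -> : (w - v) / w = - ((v - w) / w) by rewrite -mulNr opprB.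
    by lra.
  rewrite mulrA ler_pdivrMr// -mulrA [(w - v) * w]mulrC mulrA in h2.
  by rewrite ler_pM2r ?subr_gt0 in h2.
have h3 := ln_le w z w0 z0.
have h4 : e * (ln z - ln w) <= t * (z - w); last by lra.
apply: (@le_trans _ _ (e * ((z - w) / w))); first by rewrite ler_wpM2l.
by rewrite mulrA ler_pdivrMr// mulrAC ler_pM2r// subr_gt0.
Qed.

(** Provides the dominating function for exchanging sum and integral: against [t ^ (m - 1)] it is
    integrable at 0 as soon as [m] exceeds the maximum. *)
Lemma ftilde_partial_le : exists2 K, 0 <= K & forall (n : nat) (t : R), 0 < t ->
  `|series (fun k : nat =>
      (-1) ^+ k * (k%:R + a) `^ gamma * expR (- ((k%:R + a) `^ alpha * t))) n|
  <= K * t `^ (- Num.max (gamma / alpha) 0) * expR (- (a `^ alpha / 2 * t)).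
Proof.
set c := Num.max _ _.
have c0 : 0 <= c by rewrite le_max lexx orbT.
(* For [gamma >= 0] this is an equality with [K1 = 1]; for [gamma < 0], [c = 0] and the first term
   is the largest. *)
have [K1 K10 hK1] : exists2 K1, 0 <= K1 & forall k : nat,
    (k%:R + a) `^ gamma <= K1 * ((k%:R + a) `^ alpha) `^ c.
  have [g0|g0] := lerP 0 gamma.
    exists 1 => // k; rewrite mul1r -powRrM /c max_l ?divr_ge0 ?(ltW alpha0)//.
    by rewrite mulrC divfK ?lt0r_neq0.
  exists (a `^ gamma) => [|k]; first exact: powR_ge0.
  rewrite /c max_r; last by rewrite pmulr_lle0 ?invr_gt0// ltW.
  rewrite powRr0 mulr1 -(opprK gamma) !(powRN _ (- gamma)).
  rewrite lef_pV2 ?posrE ?powR_gt0 ?base_gt0//.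
  apply: ge0_ler_powR; rewrite ?nnegrE ?(ltW a0) ?(ltW (base_gt0 _ _ a0 _))//.
    by rewrite oppr_ge0 ltW.
  by rewrite lerDr.
exists (2 * (K1 * (2 `^ c * c `^ c))); first by rewrite !mulr_ge0 ?powR_ge0.
move=> n t t0.
pose g k := (k%:R + a) `^ gamma * expR (- ((k%:R + a) `^ alpha * t)).
rewrite /series /=; under eq_bigr do rewrite -mulrA.
rewrite -!mulrA; apply: (@unimodal_alternating_sum _ g) => k.
  rewrite mulr_ge0 ?powR_ge0 ?expR_ge0//=.
  have v0 := freq_gt0 k.
  rewrite /g; have := hK1 k; set v := (k%:R + a) `^ alpha in v0 *; move=> hk.
  have y0 : 0 < v * t / 2 by rewrite divr_gt0// mulr_gt0.
  have h := powR_expR_le R c _ c0 y0.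
  apply: (@le_trans _ _ (K1 * v `^ c * expR (- (v * t)))).
    by rewrite ler_wpM2r ?expR_ge0.
  rewrite -!mulrA ler_wpM2l//.
  have -> : v `^ c = (v * t / 2) `^ c * (2 `^ c * t `^ (- c)).
    rewrite -mulrA !powRM ?(ltW v0) ?(ltW t0) ?divr_ge0 ?(ltW t0)//.
    rewrite powRN -powR_inv1// -powRrM mulN1r powRN.
    by field; rewrite !lt0r_neq0 ?powR_gt0.
  (* One half of the exponential absorbs [v ^ c] at the price of [t ^ (- c)]; the other half keeps
     the decay in [t]. *)
  have -> : expR (- (v * t)) = expR (- (v * t / 2)) * expR (- (v * t / 2)).
    by rewrite -expRD; congr expR; field.
  rewrite [leLHS](_ : _ = 2 `^ c * ((v * t / 2) `^ c * expR (- (v * t / 2))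
     * (t `^ (- c) * expR (- (v * t / 2))))); last ring.
  rewrite ler_wpM2l ?powR_ge0// ler_pM ?mulr_ge0 ?powR_ge0 ?expR_ge0//.
  rewrite ler_wpM2l ?powR_ge0// ler_expR lerN2 -mulrA [t / 2]mulrC.
  rewrite ler_pM2r ?mulr_gt0//.
  by have := freq_le 0 k (leq0n k); rewrite add0r.
(* As a function of the frequency, the logarithm of a term has the form [e ln w - t w] with
   [e = gamma / alpha]. *)
have gE l : g l = expR (gamma / alpha * ln ((l%:R + a) `^ alpha) -
    t * ((l%:R + a) `^ alpha)).
  rewrite /g {1}/powR (gt_eqF (base_gt0 _ _ a0 _)) -expRD ln_powR.
  by congr expR; field; exact: lt0r_neq0.
rewrite !gE !ler_expR; apply: unimodal_lnB => //; first exact: freq_gt0.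
  exact: freq_lt.
exact: freq_lt.
Qed.

End ftilde_estimates.

(** * Behaviour of f at infinity and finiteness of the supremum *)

Lemma cvg_expR_decay (R : realType) (d : R) : 0 < d ->
  expR (- (d * t)) @[t --> +oo] --> 0.
Proof.
move=> d0; apply: (@cvg_comp _ _ _ (fun t => d * t) (fun y => expR (- y)) _ +oo).
  exact: gt0_cvgMry.
exact: cvgr_expR.
Qed.

Section ftilde_asymptotics.
Context (R : realType) (a gamma alpha : R) (a0 : 0 < a) (alpha0 : 0 < alpha).

Local Notation freq k := ((k%:R + a) `^ alpha).
Local Notation term k t :=
  ((-1) ^+ k * (k%:R + a) `^ gamma * expR (- (freq k * t))).

(** For [k >= m] and [t >= 1], [e^{-lam_k t} <= e^{-lam_k} e^{-lam_m (t - 1)}], so the tail is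
    compared with the absolutely convergent series at [t = 1]. *)
Lemma ftilde_tail (m : nat) : exists2 K, 0 <= K & forall t, 1 <= t ->
  `|ftilde t a gamma alpha - \sum_(0 <= k < m) term k t|
    <= K * expR (- (freq m * t)).
Proof.
pose A k := (k%:R + a) `^ gamma * expR (- (freq k * 1)).
have A_ge0 k : 0 <= A k by rewrite mulr_ge0 ?powR_ge0 ?expR_ge0.
have cA : cvgn (series A).
  have [L L0 hL] := exp_term_le R a gamma alpha a0 alpha0 1 ltr01.
  apply: (dominated_series_cvg R _ (fun k => L * oblong_inv R k)).
    by move=> k; rewrite (ger0_norm (A_ge0 k)); exact: hL.
  exact: is_cvg_series_oblong_invZ.
have lA_ge m' : series A m' <= limn (series A).
  by apply: nondecreasing_cvgn_le => //; apply: nondecreasing_series => k _ _.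
have lA0 : 0 <= limn (series A) by apply: le_trans (lA_ge 0%N); rewrite /series/= big_nil.
exists (expR (freq m) * limn (series A)) => [|t t1].
  by rewrite mulr_ge0 ?expR_ge0.
have t0 : 0 < t by lra.
pose E := expR (- (freq m * (t - 1))).
have sE : series (fun k => E * A k) = (fun n => E * series A n).
  by apply/funext => n; rewrite /series /= mulr_sumr.
have cE : cvgn (series (fun k => E * A k)) by rewrite sE; exact: is_cvgMr.
have := series_tail_le R (fun k => term k t) (fun k => E * A k) m _
  (is_cvg_ftilde R a gamma alpha a0 alpha0 t t0) cE.
move=> /(_ _)/wrap[k mk|h].
  rewrite -mulrA norm_alternate ?mulr_ge0 ?powR_ge0 ?expR_ge0//.
  rewrite /E /A mulrCA ler_wpM2l ?powR_ge0// -expRD ler_expR mulr1.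
  have fmk := freq_le R a alpha a0 alpha0 _ _ mk.
  have : freq m * (t - 1) <= freq k * (t - 1) by rewrite ler_wpM2r// subr_ge0.
  by lra.
apply: (le_trans h); rewrite sE.
have -> : limn (fun n => E * series A n) = E * limn (series A).
  by apply: cvg_lim => //; exact: cvgMr.
rewrite -mulrBr [leRHS](_ : _ = E * limn (series A)).
  rewrite ler_wpM2l ?expR_ge0// gerBl /series/=.
  by apply: sumr_ge0.
by rewrite mulrAC -expRD; congr (expR _ * _); ring.
Qed.

(** Only the [m]-th term survives: the tail from [m + 1] on is smaller by the factor
    [e^{-(lam_{m+1} - lam_m) t}]. *)
Lemma ftilde_asymp (m : nat) :
  expR (freq m * t) * (ftilde t a gamma alpha - \sum_(0 <= k < m) term k t)
    @[t --> +oo] --> (-1) ^+ m * (m%:R + a) `^ gamma.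
Proof.
have [K K0 hK] := ftilde_tail m.+1.
have d0 : 0 < freq m.+1 - freq m.
  by rewrite subr_gt0; exact: (freq_lt R a alpha a0 alpha0).
have cK : K * expR (- ((freq m.+1 - freq m) * t)) @[t --> +oo] --> 0.
  rewrite -[0](mulr0 K); apply: cvgMr; exact: cvg_expR_decay.
apply/cvgrPdist_le => e e0; move/cvgrPdist_le: cK => /(_ e e0).
apply: filterS2 (nbhs_pinfty_ge (num_real 1)) => t t1.
rewrite sub0r normrN ger0_norm ?mulr_ge0 ?expR_ge0// => he.
have := hK t t1; rewrite big_nat_recr//= opprD addrA.
set X := ftilde _ _ _ _ - _ => h.
have -> : (-1) ^+ m * (m%:R + a) `^ gamma - expR (freq m * t) * X =
   - (expR (freq m * t) * (X - term m t)).
  rewrite -opprB; congr (- _); rewrite [RHS]mulrBr; congr (_ - _).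
  by rewrite mulrCA -expRD subrr expR0 mulr1.
rewrite normrN normrM ger0_norm ?expR_ge0//; apply: le_trans he.
apply: (le_trans (ler_wpM2l (expR_ge0 _) h)).
by rewrite mulrCA -expRD ler_wpM2l// ler_expR; lra.
Qed.

Lemma ftilde_asymp0 : expR (a `^ alpha * t) * ftilde t a gamma alpha
    @[t --> +oo] --> a `^ gamma.
Proof.
have := ftilde_asymp 0; rewrite expr0 mul1r add0r.
by under eq_fun do rewrite big_nil subr0.
Qed.

(** This is the source of strictness. In each case a rescaling of the difference between f and the
    exponential has a nonzero limit, whereas equality would make it vanish. *)
Lemma ftilde_neq_expR (C p : R) :
  \forall t \near +oo, ftilde t a gamma alpha != C * expR (- (p * t)).
Proof.
have near_neq (w : R -> R) (l : R) : w t @[t --> +oo] --> l -> l != 0 ->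
    (forall t, ftilde t a gamma alpha = C * expR (- (p * t)) -> w t = 0) ->
    \forall t \near +oo, ftilde t a gamma alpha != C * expR (- (p * t)).
  move=> wl l0 hw.
  have : \forall t \near +oo, w t != 0 by exact: cvgr_neq0 wl l0.
  by apply: filterS => t; apply: contraNneq => /hw ->.
have h0 := ftilde_asymp0.
have aneq0 : a `^ gamma != 0 by rewrite lt0r_neq0// powR_gt0.
have [pl|pl|pl] := ltgtP p (a `^ alpha).
- have [C0|C0] := eqVneq C 0.
    by apply: (near_neq _ _ h0) => // t ->; rewrite C0 mul0r mulr0.
  have d0 : 0 < a `^ alpha - p by rewrite subr_gt0.
  have c1 : expR (- ((a `^ alpha - p) * t)) *
      (expR (a `^ alpha * t) * ftilde t a gamma alpha) - C @[t --> +oo]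
      --> 0 * a `^ gamma - C.
    apply: cvgB; last exact: cvg_cst.
    by apply: cvgM h0; exact: cvg_expR_decay.
  apply: (near_neq _ _ c1) => [|t ->]; first by rewrite mul0r sub0r oppr_eq0.
  rewrite mulrA -expRD mulrCA -expRD [X in expR X](_ : _ = 0); last ring.
  by rewrite expR0 mulr1 subrr.
- have d0 : 0 < p - a `^ alpha by rewrite subr_gt0.
  have c1 : expR (a `^ alpha * t) * ftilde t a gamma alpha -
      C * expR (- ((p - a `^ alpha) * t)) @[t --> +oo] --> a `^ gamma - C * 0.
    apply: cvgB; first exact: h0.
    by apply: cvgMr; exact: cvg_expR_decay.
  apply: (near_neq _ _ c1) => [|t ->]; first by rewrite mulr0 subr0.
  rewrite mulrCA -expRD -mulrBr -[RHS](mulr0 C); congr (_ * _).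
  by apply/eqP; rewrite subr_eq0; apply/eqP; congr expR; ring.
(* When the exponential is exactly the leading term of f, the second term
   [-(1 + a) ^ gamma * e^{-lam_1 t}] decides. *)
- have [Ca|Ca] := eqVneq C (a `^ gamma).
    apply: (near_neq _ _ (ftilde_asymp 1)).
      by rewrite expr1 mulN1r oppr_eq0 lt0r_neq0// powR_gt0// addr_gt0.
    by move=> t ->; rewrite big_nat1 expr0 mul1r add0r pl Ca subrr mulr0.
  have c1 : expR (a `^ alpha * t) * ftilde t a gamma alpha - C @[t --> +oo]
      --> a `^ gamma - C by apply: cvgB; [exact: h0|exact: cvg_cst].
  apply: (near_neq _ _ c1) => [|t ->]; first by rewrite subr_eq0 eq_sym.
  by rewrite pl mulrCA -expRD subrr expR0 mulr1 subrr.
Qed.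

Lemma Csup_gt0 (p : R) : (0 < Csup p a gamma alpha)%E.
Proof.
have [T [_ hT]] : \forall t \near +oo,
    0 < expR (a `^ alpha * t) * ftilde t a gamma alpha.
  by apply: (cvgr_gt _ ftilde_asymp0); rewrite powR_gt0.
pose t := Num.max (T + 1) 1.
have Tt : T < t by rewrite lt_max ltrDl ltr01.
have t0 : 0 < t by rewrite lt_max ltr01 orbT.
have := hT t Tt; rewrite pmulr_rgt0 ?expR_gt0// => f0.
apply: (@lt_le_trans _ _ (expR (p * t) * ftilde t a gamma alpha)%:E).
  by rewrite lte_fin mulr_gt0// expR_gt0.
by apply: ereal_sup_ubound; exists t.
Qed.

(** On [t <= 1] the uniform bound on f applies; on [t > 1] the decay [e^{-lam_0 t}] compensates
    [e^{p t}]. *)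
Lemma Csup_lty (p : R) : 0 <= p -> p <= a `^ alpha -> (Csup p a gamma alpha < +oo)%E.
Proof.
move=> p0 pl.
have [B hB] := ftilde_bounded R a gamma alpha a0 alpha0.
have [K K0 hK] := ftilde_tail 0.
apply: (@le_lt_trans _ _ (Num.max (expR p * B) K)%:E); last exact: ltry.
apply: ge_ereal_sup => _ [t /= t0 <-]; rewrite lee_fin le_max.
have [t1|t1] := leP t 1.
  apply/orP; left; apply: (@le_trans _ _ (expR p * `|ftilde t a gamma alpha|)).
    apply: (@le_trans _ _ (expR (p * t) * `|ftilde t a gamma alpha|)).
      by rewrite ler_wpM2l ?expR_ge0// ler_norm.
    rewrite ler_wpM2r// ler_expR -[leRHS]mulr1.
    by rewrite ler_wpM2l.
  by rewrite ler_wpM2l ?expR_ge0// hB.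
apply/orP; right.
have := hK t (ltW t1); rewrite big_nil subr0 add0r => h.
apply: (@le_trans _ _ (expR (p * t) * (K * expR (- (a `^ alpha * t))))).
  by rewrite ler_wpM2l ?expR_ge0//; apply: le_trans h; exact: ler_norm.
rewrite mulrCA -expRD -[leRHS]mulr1 ler_wpM2l// -expR0 ler_expR.
by rewrite subr_le0 ler_pM2r//; lra.
Qed.

Lemma Csup_pinfty (p : R) : a `^ alpha < p -> Csup p a gamma alpha = +oo%E.
Proof.
move=> pl; apply/eqyP => A A0.
pose c := a `^ gamma / 2.
have c0 : 0 < c by rewrite divr_gt0// powR_gt0.
have hc : \forall t \near +oo, c < expR (a `^ alpha * t) * ftilde t a gamma alpha.
  by apply: (cvgr_gt _ ftilde_asymp0); rewrite /c; have := powR_gt0 gamma a0; lra.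
have d0 : 0 < p - a `^ alpha by rewrite subr_gt0.
(* Threshold past which [e^{(p - lam_0) t} >= (p - lam_0) t >= A / c]. *)
have hd : \forall t \near +oo, A / c / (p - a `^ alpha) <= t.
  by apply: nbhs_pinfty_ge; rewrite num_real.
have h0 : \forall t \near +oo, (0 : R) < t by apply: nbhs_pinfty_gt; rewrite num_real.
have [t [[ht dt] t0]] := filter_ex (filterI (filterI hc hd) h0).
apply: (@le_trans _ _ (expR (p * t) * ftilde t a gamma alpha)%:E); last first.
  by apply: ereal_sup_ubound; exists t.
rewrite lee_fin.
have -> : expR (p * t) * ftilde t a gamma alpha = expR ((p - a `^ alpha) * t) *
    (expR (a `^ alpha * t) * ftilde t a gamma alpha).
  by rewrite mulrA -expRD; congr (expR _ * _); ring.
apply: (@le_trans _ _ (expR ((p - a `^ alpha) * t) * c)); last first.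
  by rewrite ler_wpM2l ?expR_ge0// ltW.
rewrite -ler_pdivrMr//; apply: (@le_trans _ _ ((p - a `^ alpha) * t)).
  by move: dt; rewrite (ler_pdivrMr _ _ d0) [t * _]mulrC.
by apply: le_trans (expR_ge1Dx _); rewrite lerDr.
Qed.

End ftilde_asymptotics.

(** * Post-Widder approximation of exponentials along [x = mu / t] *)

Lemma exprn_ge1Dn (R : realFieldType) (z : R) (n : nat) : 0 <= z ->
  1 + n%:R * z <= (1 + z) ^+ n.
Proof.
move=> z0; elim: n => [|n IH]; first by rewrite mul0r addr0 expr0.
rewrite exprS; apply: (@le_trans _ _ ((1 + z) * (1 + n%:R * z))); last first.
  by rewrite ler_wpM2l// addr_ge0.
rewrite -natr1; have : 0 <= n%:R * z * z by rewrite !mulr_ge0.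
by move: (n%:R : R) => x; nra.
Qed.

Lemma divrDl_inv (R : realFieldType) (x y : R) : 0 < x -> 0 <= y ->
  x / (y + x) = (1 + y / x)^-1.
Proof.
move=> x0 y0; field; rewrite !lt0r_neq0//.
by rewrite ltr_wpDr.
Qed.

Section post_widder.
Context (R : realType) (M : nat) (t : R) (M0 : (0 < M)%N) (t0 : 0 < t).

Local Notation N j := (M * j.+1)%N.
Local Notation X j := ((M * j.+1)%:R / t).

Lemma node_gt0 j : 0 < X j.
Proof. by rewrite divr_gt0// ltr0n muln_gt0 M0. Qed.

(** With [z = y / X] the power is [e^{-N ln (1 + z)}] and [N z = y t]; the bounds
    [z / (1 + z) <= ln (1 + z) <= z] squeeze it, as [z] tends to 0. *)
Lemma cvg_post_widder (y : R) : 0 <= y ->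
  (X j / (y + X j)) ^+ N j @[j --> \oo] --> expR (- (y * t)).
Proof.
move=> y0.
have MN0 : (M%:R : R) != 0 by rewrite lt0r_neq0// ltr0n.
pose z j : R := y / X j.
have z0 j : 0 <= z j by rewrite divr_ge0// ltW// node_gt0.
have zE j : z j = y * t / M%:R * harmonic j.
  rewrite /z natrM /harmonic /=; field.
  by rewrite MN0 (lt0r_neq0 t0) lt0r_neq0// ltr_pwDl.
have cz : 1 + z j @[j --> \oo] --> (1 : R).
  rewrite -[Y in _ --> Y](@addr0 R 1); apply: cvgD; first exact: cvg_cst.
  rewrite (funext zE).
  by rewrite -[0](mulr0 (y * t / M%:R)); apply: cvgMr; exact: cvg_harmonic.
have E j : (X j / (y + X j)) ^+ N j = expR (- ((N j)%:R * ln (1 + z j))).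
  have x0 := node_gt0 j.
  have -> : X j / (y + X j) = (1 + z j)^-1.
    exact: divrDl_inv.
  have p1 : 0 < 1 + z j by rewrite ltr_wpDr.
  by rewrite expRN expRM_natl lnK ?posrE// exprVn.
have zN j : (N j)%:R * z j = y * t.
  rewrite /z natrM; field.
  by rewrite MN0 (lt0r_neq0 t0) lt0r_neq0// ltr_pwDl.
have lb j : expR (- (y * t)) <= (X j / (y + X j)) ^+ N j.
  rewrite E ler_expR lerN2 -(zN j) ler_wpM2l//.
  by apply: le_ln1Dx; apply: lt_le_trans (z0 j).
have ub j : (X j / (y + X j)) ^+ N j <= expR (- (y * t * (1 + z j)^-1)).
  have p1 : 0 < 1 + z j by rewrite ltr_wpDr.
  rewrite E ler_expR lerN2 -(zN j) -mulrA ler_wpM2l//.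
  rewrite -lerN2 -lnV ?posrE//.
  have e : (1 + z j)^-1 = 1 + (- (z j / (1 + z j))) by field; exact: lt0r_neq0.
  rewrite [in leLHS]e.
  apply: le_ln1Dx; rewrite ltrN2 ltr_pdivrMr// mul1r.
  by rewrite ltrDr.
apply: (@squeeze_cvgr _ _ _ _ (fun=> expR (- (y * t)))
  (fun j => expR (- (y * t * (1 + z j)^-1)))).
- by exists 0%N => // j _; rewrite lb ub.
- exact: cvg_cst.
- apply: continuous_cvg; first exact: continuous_expR.
  apply: cvgN; rewrite -[Y in _ --> Y]divr1.
  by apply: cvgMr; apply: cvgV => //; exact: oner_neq0.
Qed.

(** With [w = y t / M], Bernoulli gives [(1 + w / (j + 1)) ^ (j + 1) >= w]; raising to the power [M]
    yields a majorant free of [j]. *)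
Lemma post_widder_le (j : nat) (y : R) : 0 < y ->
  (X j / (y + X j)) ^+ N j <= (M%:R / t) ^+ M * y ^- M.
Proof.
move=> y0; have x0 := node_gt0 j.
have M0' : 0 < (M%:R : R) by rewrite ltr0n.
have yt0 : 0 < y * t / M%:R by rewrite divr_gt0// mulr_gt0.
have -> : (M%:R / t) ^+ M * y ^- M = (y * t / M%:R) ^- M.
  rewrite -!exprVn -exprMn; congr (_ ^+ _); field.
  by rewrite !lt0r_neq0.
have -> : X j / (y + X j) = (1 + y * t / M%:R / j.+1%:R)^-1.
  rewrite divrDl_inv ?(ltW y0)//; congr (1 + _)^-1.
  rewrite natrM; field.
  by rewrite (lt0r_neq0 M0') (lt0r_neq0 t0) lt0r_neq0// ltr_pwDl.
rewrite exprVn lef_pV2 ?posrE ?exprn_gt0//; last by rewrite addr_gt0// divr_gt0.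
rewrite mulnC exprM; apply: lerXn2r; rewrite ?nnegrE ?(ltW yt0)//.
  by rewrite exprn_ge0// addr_ge0// divr_ge0// ltW.
have := @exprn_ge1Dn R (y * t / M%:R / j.+1%:R) j.+1.
rewrite mulrCA divff ?pnatr_eq0// mulr1 divr_ge0 ?(ltW yt0)// => /(_ isT).
by apply: le_trans; rewrite lerDr.
Qed.

End post_widder.

(** * From bounds on S back to bounds on f *)

Section necessity.
Context (R : realType) (a gamma alpha : R) (a0 : 0 < a) (alpha0 : 0 < alpha).

(* Integer exponents [M * j.+1] let the integer Bernoulli inequality provide the
   summable majorant [(k + a) ^ (gamma - alpha * M)], uniform in [j]. *)
Lemma cvg_Stilde_ftilde (M : nat) (t : R) : (0 < M)%N -> 0 < t ->
  gamma - alpha * M%:R <= -2 ->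
  ((M * j.+1)%:R / t) ^+ (M * j.+1) *
    Stilde ((M * j.+1)%:R / t) a gamma alpha (M * j.+1)%:R @[j --> \oo]
  --> ftilde t a gamma alpha.
Proof.
move=> M0 t0 gM.
have [K K0 hK] := powR_le_oblong_inv R a _ a0 gM.
pose X j : R := (M * j.+1)%:R / t.
pose U j k : R := (-1) ^+ k * (k%:R + a) `^ gamma *
  (X j / ((k%:R + a) `^ alpha + X j)) ^+ (M * j.+1).
have X0 j : 0 < X j by exact: node_gt0.
have f0 k := freq_gt0 R a alpha a0 k.
have UM j k : `|U j k| <= (M%:R / t) ^+ M * K * oblong_inv R k.
  rewrite /U -mulrA norm_alternate; last first.
    rewrite mulr_ge0 ?powR_ge0 ?exprn_ge0// divr_ge0 ?(ltW (X0 _))//.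
    by rewrite addr_ge0// ltW.
  apply: (@le_trans _ _ ((k%:R + a) `^ gamma *
      ((M%:R / t) ^+ M * ((k%:R + a) `^ alpha) ^- M))).
    by rewrite ler_wpM2l ?powR_ge0//; exact: post_widder_le.
  rewrite mulrCA -mulrA ler_wpM2l ?exprn_ge0 ?divr_ge0 ?(ltW t0)//.
  apply: le_trans (hK k).
  rewrite -powR_mulrn ?powR_ge0// -powRrM -powRN -powRD//.
  by rewrite (gt_eqF (base_gt0 _ _ a0 _)) implybT.
have cM := is_cvg_series_oblong_invZ R ((M%:R / t) ^+ M * K).
have -> : (fun j => X j ^+ (M * j.+1) * Stilde (X j) a gamma alpha (M * j.+1)%:R)
    = (fun j => limn (series (U j))).
  apply/funext => j.
  have xn0 : X j ^+ (M * j.+1) != 0 by rewrite lt0r_neq0// exprn_gt0.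
  (* Taking the constant factor out of [limn] requires convergence, which the majorant supplies. *)
  have cU := dominated_series_cvg R _ _ (UM j) cM.
  rewrite /Stilde [X in limn X](_ : _ =
      (fun n => (X j ^+ (M * j.+1))^-1 * series (U j) n)).
    have -> : limn (fun n => (X j ^+ (M * j.+1))^-1 * series (U j) n) =
        (X j ^+ (M * j.+1))^-1 * limn (series (U j)).
      by apply: cvg_lim => //; exact: cvgMr.
    by rewrite mulrA divff// mul1r.
  apply/funext => n; rewrite /series /= mulr_sumr; apply: eq_bigr => k _.
  rewrite powR_mulrn; last by rewrite addr_ge0 ?(ltW (X0 _)) ?(ltW (f0 _)).
  rewrite /U; move: (X j) xn0 => x xn0; rewrite expr_div_n [RHS]mulrC -!mulrA; congr (_ * (_ * _)).
  by rewrite mulrCA divff// mulr1.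
rewrite /ftilde; apply: (tannery _ _ _ _ UM cM) => k.
apply: cvgMr; apply: cvg_post_widder => //; exact: ltW.
Qed.

(** Multiplied by [X ^ N], all three members converge: the middle one to f, the outer ones by the
    same Post-Widder limit with [q] and [p] in the role of the frequency. *)
Lemma Stilde_bounds_ftilde (mu0 q p C F : R) : 0 <= q -> 0 <= p ->
  (forall mu x : R, mu0 < mu -> 0 < x ->
      F / (q + x) `^ mu <= Stilde x a gamma alpha mu
      /\ Stilde x a gamma alpha mu <= C / (p + x) `^ mu) ->
  forall t, 0 < t -> F * expR (- (q * t)) <= ftilde t a gamma alpha
    /\ ftilde t a gamma alpha <= C * expR (- (p * t)).
Proof.
move=> q0 p0 H t t0.
(* Large enough for every exponent [M * j.+1] to exceed [mu0] and for the majorant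
   [(k + a) ^ (gamma - alpha * M)] to be summable. *)
pose M := (Num.truncn (`|mu0| + `|(gamma + 2) / alpha|)).+1.
have hM : `|mu0| + `|(gamma + 2) / alpha| < M%:R.
  by rewrite Num.Theory.truncnS_gt.
have gM : gamma - alpha * M%:R <= -2.
  have : (gamma + 2) / alpha <= M%:R.
    apply: (le_trans (ler_norm _)); apply/ltW; apply: le_lt_trans hM.
    by rewrite lerDr.
  by rewrite ler_pdivrMr// mulrC; lra.
have mM : mu0 < M%:R.
  apply: (le_lt_trans (ler_norm _)); apply: le_lt_trans hM.
  by rewrite lerDl.
have M0 : (0 < M)%N by [].
have cS := cvg_Stilde_ftilde M t M0 t0 gM.
pose X j : R := (M * j.+1)%:R / t.
have X0 j : 0 < X j by exact: node_gt0.
have mN j : mu0 < (M * j.+1)%:R.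
  by apply: (lt_le_trans mM); rewrite ler_nat leq_pmulr.
have E (D r : R) j : 0 <= r -> X j ^+ (M * j.+1) * (D / (r + X j) `^ (M * j.+1)%:R) =
    D * (X j / (r + X j)) ^+ (M * j.+1).
  move=> r0; have rx : 0 < r + X j by rewrite ltr_wpDl.
  rewrite powR_mulrn ?(ltW rx)//; move: (X j) => x.
  by rewrite expr_div_n mulrCA.
have cD D r : 0 <= r -> D * (X j / (r + X j)) ^+ (M * j.+1) @[j --> \oo] -->
    D * expR (- (r * t)).
  by move=> r0; apply: cvgMr; exact: cvg_post_widder.
have xn0 j : 0 <= X j ^+ (M * j.+1) by rewrite exprn_ge0// ltW.
split.
  apply: (@ler_cvg_to _ eventually _ R _ _ _ _ (cD F q q0) cS).
  exists 0%N => // j _ /=; rewrite -(E _ _ _ q0); apply: (ler_wpM2l (xn0 j)).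
  by have [] := H _ _ (mN j) (X0 j).
apply: (@ler_cvg_to _ eventually _ R _ _ _ _ cS (cD C p p0)).
exists 0%N => // j _ /=; rewrite -(E _ _ _ p0); apply: (ler_wpM2l (xn0 j)).
by have [] := H _ _ (mN j) (X0 j).
Qed.

End necessity.

(** * Strict positivity of integrals *)

Lemma ge0_integral_gt0 (R : realType) (h : R -> R) :
  measurable_fun setT h -> (forall s, 0 <= h s) ->
  (\forall s \near +oo, h s != 0) ->
  (0 < \int[@lebesgue_measure R]_s (h s)%:E)%E.
Proof.
move=> mh h0 [T [_ hT]].
have i0 : (0 <= \int[@lebesgue_measure R]_s (h s)%:E)%E.
  by apply: integral_ge0 => s _; rewrite lee_fin.
rewrite lt_neqAle i0 andbT eq_sym; apply/eqP => ih.
have mhE : measurable_fun setT (EFin \o h) by apply/measurable_EFinP.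
(* A zero integral would make [h] vanish almost everywhere, yet [h] is nonzero on a ray of infinite
   measure. *)
have ah : (\int[@lebesgue_measure R]_s `|(EFin \o h) s| = 0)%E.
  by rewrite -ih; apply: eq_integral => s _ /=; rewrite ger0_norm.
have [N [mN N0 hN]] := iffLR (@ae_eq_integral_abs _ _ _ (@lebesgue_measure R) setT measurableT _ mhE) ah.
have TN : `]T, +oo[%classic `<=` N.
  move=> s /=; rewrite in_itv/= andbT => Ts; apply: hN => /= /(_ I) [] hs.
  by move: (hT s Ts); rewrite hs eqxx.
have := le_measure (@lebesgue_measure R) _ _ TN.
rewrite !inE => /(_ (measurable_itv _) mN).
have eT : lebesgue_measure (`]T, +oo[%classic : set R) = +oo%E.
  by rewrite lebesgue_measure_itv/= ltry.
have leN : (lebesgue_measure N <= 0)%E by rewrite N0.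
by move=> /le_trans/(_ leN) le0; have := le0; rewrite [leLHS]eT.
Qed.

Lemma Rintegral_gt0 (R : realType) (h : R -> R) :
  (@lebesgue_measure R).-integrable setT (EFin \o h) -> (forall s, 0 <= h s) ->
  (\forall s \near +oo, h s != 0) -> 0 < \int[@lebesgue_measure R]_s h s.
Proof.
move=> ih h0 hn; have mh : measurable_fun setT h.
  by apply/measurable_EFinP; exact: (measurable_int (@lebesgue_measure R) ih).
(* [fine] sends [+oo] to 0, so positivity of the real integral also rests on integrability. *)
apply: fine_gt0; rewrite ge0_integral_gt0//=.
exact: (integrable_lty measurableT ih).
Qed.

(** * The Gamma integral in logarithmic scale *)

Section gamma_kernel.
Context (R : realType).
Local Notation mu := (@lebesgue_measure R).

(* The integrand of Gamma after the substitution [t = e^s]. This turns scaling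
   in [t] into translation in [s], and all integrands are continuous on [R]. *)
Definition gamma_kernel (m lam s : R) : R := expR (m * s - lam * expR s).

Lemma continuous_gamma_kernel (m lam : R) : continuous (gamma_kernel m lam).
Proof.
move=> s; apply: continuous_comp; last exact: continuous_expR.
apply: cvgB; first by apply: cvgMr; exact: cvg_id.
by apply: cvgMr; exact: continuous_expR.
Qed.

Lemma measurable_gamma_kernel (m lam : R) :
  measurable_fun setT (gamma_kernel m lam).
Proof. by apply: continuous_measurable_fun; exact: continuous_gamma_kernel. Qed.

Lemma gamma_kernel_ge0 (m lam s : R) : 0 <= gamma_kernel m lam s.
Proof. exact: expR_ge0. Qed.

Lemma gamma_kernel_le (m s : R) : 0 < m -> gamma_kernel m 1 s <=
  expR `|2 * m * ln (2 * m)| * expR (- (m * `|s|)).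
Proof.
move=> m0; rewrite /gamma_kernel mul1r -expRD ler_expR.
set L := ln (2 * m).
have n1 := ler_norm (2 * m * L).
have n0 := normr_ge0 (2 * m * L).
have e0 := expR_ge0 s.
have [s0|s0] := leP 0 s; last by rewrite (ltr0_norm s0) mulrN; lra.
rewrite (ger0_norm s0).
(* The tangent to [e^s] at [L = ln (2 m)] has slope [2 m], which turns the growth [m s] into the
   decay [- m s]. *)
have h := expR_ge1Dx (s - L).
have m20 : 0 < 2 * m by lra.
rewrite expRB /L lnK ?posrE// ler_pdivlMr// -/L in h.
nra.
Qed.

(** By symmetry the integral is twice that of the exponential density, hence 2. *)
Lemma integrable_laplace_density (d : R) : 0 < d ->
  mu.-integrable setT (fun s : R => (d * expR (- (d * `|s|)))%:E).
Proof.
move=> d0.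
have cf : continuous (fun s : R => d * expR (- (d * `|s|))).
  move=> s; apply: cvgMr; apply: continuous_comp; last exact: continuous_expR.
  by apply: cvgN; apply: cvgMr; exact: norm_continuous.
have f0 (s : R) : 0 <= d * expR (- (d * `|s|)) by rewrite mulr_ge0 ?expR_ge0// ltW.
apply/integrableP; split.
  by apply/measurable_EFinP; exact: continuous_measurable_fun.
under eq_integral do rewrite /= ger0_norm//.
rewrite ge0_symfun_integralT//; last by move=> s /=; rewrite normrN.
rewrite [X in (2 * X)%E](_ : _ = 1%E) ?mule1 ?ltry//.
rewrite -(integral_exponential_pdf d0) [RHS](_ : _ =
   \int[mu]_(s in `[0%R, +oo[) (d * expR (- d * s))%:E)%E; last first.
  rewrite [RHS]integral_mkcond; apply: eq_integral => s _.
  by rewrite /exponential_pdf !patchE; case: ifP.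
rewrite set_itvcy; apply: eq_integral => s; rewrite inE/= => s0.
by rewrite ger0_norm// mulNr.
Qed.

Lemma integrable_gamma_kernel1 (m : R) : 0 < m ->
  mu.-integrable setT (EFin \o gamma_kernel m 1).
Proof.
move=> m0; pose K := expR `|2 * m * ln (2 * m)| / m.
have iK := integrableZl measurableT K (integrable_laplace_density m m0).
apply: (le_integrable measurableT _ _ iK).
  by apply/measurable_EFinP; exact: measurable_gamma_kernel.
move=> s _; rewrite /= lee_fin.
have g0 : 0 <= K * (m * expR (- (m * `|s|))).
  by rewrite /K !mulr_ge0 ?invr_ge0 ?expR_ge0// ltW.
rewrite (ger0_norm (gamma_kernel_ge0 _ _ _)) (ger0_norm g0).
rewrite /K mulrA divfK ?lt0r_neq0//; exact: gamma_kernel_le.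
Qed.

(** Translating by [ln lam] absorbs [lam] and produces [lam ^ (- m)]. Stated in the extended reals,
    so that integrability for general [lam] can be deduced from it. *)
Lemma integral_gamma_kernel (m lam : R) : 0 < lam ->
  (\int[mu]_s (gamma_kernel m lam s)%:E =
   (lam `^ (- m))%:E * \int[mu]_s (gamma_kernel m 1 s)%:E)%E.
Proof.
move=> lam0; pose F := shift (ln lam) : R -> R.
have dF : derive1 F = cst 1.
  by apply/funext => s; rewrite derive1E; have [_] := @is_derive_shift R s 1 (ln lam).
have FE s : F s = s + ln lam by [].
have cF : continuous F.
  by move=> s; apply: cvgD; [exact: cvg_id|exact: cvg_cst].
have mF : measurable_fun setT (gamma_kernel m 1 \o F).
  apply: continuous_measurable_fun => s; apply: continuous_comp; first exact: cF.
  exact: continuous_gamma_kernel.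
have KE s : gamma_kernel m lam s = lam `^ (- m) * gamma_kernel m 1 (F s).
  rewrite /gamma_kernel FE (expRD s) lnK ?posrE// /powR gt_eqF//= -expRD.
  by congr expR; ring.
under eq_integral do rewrite KE EFinM.
have mFE : measurable_fun setT (fun s => (gamma_kernel m 1 (F s))%:E).
  exact/measurable_EFinP.
have F0 s : setT s -> (0 <= (gamma_kernel m 1 (F s))%:E)%E.
  by rewrite lee_fin gamma_kernel_ge0.
rewrite (ge0_integralZl mu measurableT mFE F0); last by rewrite lee_fin powR_ge0.
suff -> : (\int[mu]_s (gamma_kernel m 1 (F s))%:E =
  \int[mu]_s (gamma_kernel m 1 s)%:E)%E by [].
rewrite [RHS](@increasing_ge0_integration_by_substitutionT R F (gamma_kernel m 1)).
- by apply: eq_integral => s _; rewrite !fctE dF /= mulr1.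
- by move=> x y; rewrite !FE ltrD2r.
- by rewrite dF => s; exact: cvg_cst.
- by rewrite dF; apply/cvg_ex; exists 1; exact: cvg_cst.
- by rewrite dF; apply/cvg_ex; exists 1; exact: cvg_cst.
- by move=> s; have [] := @is_derive_shift R s 1 (ln lam).
- by apply: cvg_addrr_Ny.
- by apply: cvg_addrr.
- exact: continuous_gamma_kernel.
- exact: gamma_kernel_ge0.
Qed.

(** Euler's Gamma function at [m], for [m > 0]. *)
Definition gamma_mass (m : R) : R := \int[mu]_s gamma_kernel m 1 s.

Lemma gamma_massE (m : R) : 0 < m ->
  (gamma_mass m)%:E = (\int[mu]_s (gamma_kernel m 1 s)%:E)%E.
Proof.
move=> m0; rewrite /gamma_mass /Rintegral fineK//.
by apply: integrable_fin_num => //; exact: integrable_gamma_kernel1.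
Qed.

Lemma gamma_mass_gt0 (m : R) : 0 < m -> 0 < gamma_mass m.
Proof.
move=> m0; rewrite -lte_fin gamma_massE//; apply: ge0_integral_gt0.
- exact: measurable_gamma_kernel.
- exact: gamma_kernel_ge0.
- by exists 0; split => // s _; rewrite /gamma_kernel expR_eq0.
Qed.

Lemma integrable_gamma_kernel (m lam : R) : 0 < m -> 0 < lam ->
  mu.-integrable setT (EFin \o gamma_kernel m lam).
Proof.
move=> m0 lam0; apply/integrableP; split.
  by apply/measurable_EFinP; exact: measurable_gamma_kernel.
under eq_integral do rewrite /= ger0_norm ?gamma_kernel_ge0//.
by rewrite integral_gamma_kernel// -gamma_massE// -EFinM ltry.
Qed.

Lemma Rintegral_gamma_kernel (m lam : R) : 0 < m -> 0 < lam ->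
  \int[mu]_s gamma_kernel m lam s = gamma_mass m / lam `^ m.
Proof.
move=> m0 lam0; rewrite /Rintegral integral_gamma_kernel// -gamma_massE// -EFinM.
by rewrite /= powRN mulrC.
Qed.

End gamma_kernel.

(** * S as a weighted integral of f *)

Section Stilde_integral.
Context (R : realType) (a gamma alpha : R) (a0 : 0 < a) (alpha0 : 0 < alpha).
Local Notation mu := (@lebesgue_measure R).
Context (m x : R) (m_gt : Num.max (gamma / alpha) 0 < m) (x0 : 0 <= x).

Local Notation freq k := ((k%:R + a) `^ alpha).
Let F n (t : R) := series (fun k : nat =>
  (-1) ^+ k * (k%:R + a) `^ gamma * expR (- (freq k * t))) n.
Let S n := series (fun k : nat =>
  (-1) ^+ k * (k%:R + a) `^ gamma / (freq k + x) `^ m) n.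

Let m0 : 0 < m.
Proof. by apply: le_lt_trans m_gt; rewrite le_max lexx orbT. Qed.

(** Multiplying the kernel of parameter [x] by [e^{-lam t}] with [t = e^s] gives the kernel of
    parameter [lam + x]. *)
Lemma integral_ftilde_partial n :
  mu.-integrable setT (EFin \o (fun s => gamma_kernel R m x s * F n (expR s))) /\
  \int[mu]_s (gamma_kernel R m x s * F n (expR s)) = gamma_mass R m * S n.
Proof.
elim: n => [|n [iF eF]].
  have -> : (fun s => gamma_kernel R m x s * F 0 (expR s)) = cst 0.
    by apply/funext => s; rewrite /F /series /= big_nil mulr0.
  split; first exact: integrable0.
  by rewrite /Rintegral integral0 /S /series /= big_nil mulr0.
have l0 : 0 < freq n + x by rewrite ltr_wpDr// freq_gt0.
pose c := (-1) ^+ n * (n%:R + a) `^ gamma.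
have iK := integrable_gamma_kernel R m _ m0 l0.
have icK : mu.-integrable setT
    (EFin \o (fun s => c * gamma_kernel R m (freq n + x) s)).
  by apply: eq_integrable (integrableZl measurableT c iK) => // s _ /=; rewrite EFinM.
have FE : (fun s => gamma_kernel R m x s * F n.+1 (expR s)) =
    (fun s => gamma_kernel R m x s * F n (expR s) +
              c * gamma_kernel R m (freq n + x) s).
  apply/funext => s; rewrite /F seriesSr mulrDr; congr (_ + _).
  rewrite -/c mulrCA /gamma_kernel -expRD; congr (_ * expR _); ring.
split.
  rewrite FE.
  by apply: eq_integrable (integrableD measurableT iF icK) => // s _ /=; rewrite EFinD.
by rewrite FE RintegralD// eF RintegralZl// Rintegral_gamma_kernel// /S seriesSr
  mulrDr; congr (_ + _); rewrite mulrCA.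
Qed.

Lemma integral_ftilde :
  mu.-integrable setT
    (EFin \o (fun s => gamma_kernel R m x s * ftilde (expR s) a gamma alpha)) /\
  \int[mu]_s (gamma_kernel R m x s * ftilde (expR s) a gamma alpha) =
    gamma_mass R m * Stilde x a gamma alpha m.
Proof.
pose g n s := gamma_kernel R m x s * F n (expR s).
pose G s := gamma_kernel R m x s * ftilde (expR s) a gamma alpha.
have ig n : mu.-integrable setT (EFin \o g n) := (integral_ftilde_partial n).1.
have mgE n : measurable_fun setT (EFin \o g n) := measurable_int mu (ig n).
have mg n : measurable_fun setT (g n) by exact/measurable_EFinP.
have gG s : g n s @[n --> \oo] --> G s.
  apply: cvgMr; apply: (is_cvg_ftilde R a gamma alpha a0 alpha0); exact: expR_gt0.
have mG : measurable_fun setT G by apply: measurable_fun_cvg mg _ => s _; exact: gG.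
have [K K0 hK] := ftilde_partial_le R a gamma alpha a0 alpha0.
set c := Num.max _ _ in hK.
have mc0 : 0 < m - c by rewrite subr_gt0; exact: m_gt.
have l0 : 0 < a `^ alpha / 2 by rewrite divr_gt0// powR_gt0.
have iK := integrableZl measurableT K (integrable_gamma_kernel R _ _ mc0 l0).
(* With [t = e^s], the factor [t ^ (- c)] lowers the exponent [m] to [m - c > 0], and
   [e^{-x t} <= 1]. *)
have gK s n : `|g n s| <= K * gamma_kernel R (m - c) (a `^ alpha / 2) s.
  rewrite /g normrM ger0_norm ?gamma_kernel_ge0//.
  have := hK n (expR s) (expR_gt0 s); rewrite -expRM => h.
  apply: (le_trans (ler_wpM2l (gamma_kernel_ge0 R m x s) h)).
  rewrite -mulrA mulrCA ler_wpM2l// /gamma_kernel -!expRD ler_expR.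
  have : 0 <= x * expR s by rewrite mulr_ge0// expR_ge0.
  lra.
have [] := @dominated_convergence _ _ _ mu setT measurableT
  (fun n => EFin \o g n) (EFin \o G) _ mgE _ _ iK _.
- exact/measurable_EFinP.
- by apply: aeW => s _; apply/cvg_EFin; [exact: nearW|exact: gG].
- by apply: aeW => s n _; rewrite /= lee_fin; exact: gK.
move=> iG _ cI; split => //.
have iGE : (\int[mu]_s (EFin \o G) s = (\int[mu]_s G s)%:E)%E.
  by rewrite /Rintegral fineK//; exact: integrable_fin_num.
rewrite iGE in cI.
have cS : gamma_mass R m * S n @[n --> \oo] --> \int[mu]_s G s.
  have -> : (fun n => gamma_mass R m * S n) = (fun n => \int[mu]_s g n s).
    by apply/funext => n; rewrite -(integral_ftilde_partial n).2.
  exact: fine_cvg cI.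
have gm0 : gamma_mass R m != 0 by rewrite lt0r_neq0// gamma_mass_gt0.
(* Convergence of the possibly conditional series for S is a consequence here, so [limn] is a true
   limit. *)
have cS' : S n @[n --> \oo] --> (gamma_mass R m)^-1 * \int[mu]_s G s.
  have -> : S = (fun n => (gamma_mass R m)^-1 * (gamma_mass R m * S n)).
    by apply/funext => n; rewrite mulKf.
  exact: cvgMr.
rewrite /Stilde (cvg_lim _ cS')//.
by rewrite mulVKf.
Qed.

End Stilde_integral.

(** * Integrating pointwise bounds to strict ones *)

Section strict_comparison.
Context (R : realType) (a gamma alpha : R) (a0 : 0 < a) (alpha0 : 0 < alpha).
Local Notation mu := (@lebesgue_measure R).
Context (m x : R) (m_gt : Num.max (gamma / alpha) 0 < m) (x0 : 0 <= x).

Lemma near_ftilde_neq (C p : R) : \forall s \near +oo,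
  gamma_kernel R m x s *
    (C * expR (- (p * expR s)) - ftilde (expR s) a gamma alpha) != 0.
Proof.
have [T [_ hT]] := ftilde_neq_expR R a gamma alpha a0 alpha0 C p.
exists T; split => [|s /= Ts]; first exact: num_real.
rewrite mulf_neq0//; first by rewrite /gamma_kernel expR_eq0.
(* Since [e^s >= s], a threshold for [t] also serves for [s]. *)
rewrite subr_eq0 eq_sym; apply: hT; apply: (lt_le_trans Ts).
by apply: le_trans (expR_ge1Dx s); rewrite lerDr.
Qed.

(** The exponential integrates to the bound and f to S, so the gap between them has the sign of the
    integrand. Asking only [0 < p + x] admits [x = 0] when [p > 0]. *)
Lemma integral_comparison (C p : R) : 0 < p + x ->
  let D s := gamma_kernel R m x s *
    (C * expR (- (p * expR s)) - ftilde (expR s) a gamma alpha) in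
  mu.-integrable setT (EFin \o D) /\
  \int[mu]_s D s = gamma_mass R m * (C / (p + x) `^ m - Stilde x a gamma alpha m).
Proof.
move=> px0 D.
have m0 : 0 < m by apply: le_lt_trans m_gt; rewrite le_max lexx orbT.
have [iG eG] := integral_ftilde R a gamma alpha a0 alpha0 m x m_gt x0.
have iK := integrable_gamma_kernel R m _ m0 px0.
have iCK : mu.-integrable setT (EFin \o (fun s => C * gamma_kernel R m (p + x) s)).
  by apply: eq_integrable (integrableZl measurableT C iK) => // s _ /=; rewrite EFinM.
have DE : D = (fun s => C * gamma_kernel R m (p + x) s -
    gamma_kernel R m x s * ftilde (expR s) a gamma alpha).
  apply/funext => s; rewrite /D mulrBr; congr (_ - _).
  by rewrite mulrCA /gamma_kernel -expRD; congr (_ * expR _); ring.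
rewrite DE; split.
  by apply: eq_integrable (integrableB measurableT iCK iG) => // s _ /=; rewrite EFinB.
rewrite RintegralB// eG RintegralZl// Rintegral_gamma_kernel//.
by rewrite mulrBr mulrCA.
Qed.

Lemma Stilde_lt (C p : R) : 0 < p + x ->
  (forall t, 0 < t -> ftilde t a gamma alpha <= C * expR (- (p * t))) ->
  Stilde x a gamma alpha m < C / (p + x) `^ m.
Proof.
move=> px0 fC; have [iD eD] := integral_comparison C p px0.
have m0 : 0 < m by apply: le_lt_trans m_gt; rewrite le_max lexx orbT.
rewrite -subr_gt0 -(pmulr_rgt0 _ (gamma_mass_gt0 R m m0)) -eD.
apply: Rintegral_gt0 => //; last exact: near_ftilde_neq.
by move=> s; rewrite mulr_ge0 ?gamma_kernel_ge0// subr_ge0 fC// expR_gt0.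
Qed.

Lemma lt_Stilde (C p : R) : 0 < p + x ->
  (forall t, 0 < t -> C * expR (- (p * t)) <= ftilde t a gamma alpha) ->
  C / (p + x) `^ m < Stilde x a gamma alpha m.
Proof.
move=> px0 fC; have [iD eD] := integral_comparison C p px0.
have m0 : 0 < m by apply: le_lt_trans m_gt; rewrite le_max lexx orbT.
rewrite -subr_lt0 -(pmulr_rlt0 _ (gamma_mass_gt0 R m m0)) -eD.
rewrite -oppr_gt0 -mulN1r -RintegralZl//.
apply: Rintegral_gt0.
- by apply: eq_integrable (integrableZl measurableT (-1) iD) => // s _ /=; rewrite EFinM.
- move=> s; rewrite mulN1r oppr_ge0 mulr_ge0_le0 ?gamma_kernel_ge0//.
  by rewrite subr_le0 fC// expR_gt0.
- apply: filterS (near_ftilde_neq C p) => s.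
  by rewrite mulN1r oppr_eq0.
Qed.

End strict_comparison.

(** * Extremal constants as pointwise bounds, and the conclusion *)

Lemma expRM_le_shift (R : realType) (p t y C : R) :
  (expR (p * t) * y <= C) = (y <= C * expR (- (p * t))).
Proof. by rewrite expRN ler_pdivlMr ?expR_gt0// mulrC. Qed.

Lemma le_expRM_shift (R : realType) (p t y C : R) :
  (C <= expR (p * t) * y) = (C * expR (- (p * t)) <= y).
Proof. by rewrite expRN ler_pdivrMr ?expR_gt0// mulrC. Qed.

Lemma Csup_leP (R : realType) (p a gamma alpha C : R) :
  (Csup p a gamma alpha <= C%:E)%E <->
  (forall t, 0 < t -> ftilde t a gamma alpha <= C * expR (- (p * t))).
Proof.
split=> [h t t0|h].
  rewrite -expRM_le_shift -lee_fin; apply: le_trans h.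
  by apply: ereal_sup_ubound; exists t.
by apply: ge_ereal_sup => _ [t /= t0 <-]; rewrite lee_fin expRM_le_shift h.
Qed.

Lemma Finf_geP (R : realType) (q a gamma alpha F : R) :
  (F%:E <= Finf q a gamma alpha)%E <->
  (forall t, 0 < t -> F * expR (- (q * t)) <= ftilde t a gamma alpha).
Proof.
split=> [h t t0|h].
  rewrite -le_expRM_shift -lee_fin; apply: (le_trans h).
  by apply: ereal_inf_lbound; exists t.
by apply: le_ereal_inf_tmp => _ [t /= t0 <-]; rewrite lee_fin le_expRM_shift h.
Qed.

Theorem theorem2p3 (R : realType) (a gamma alpha mu0 q p C F : R)
    (ha : 0 < a) (halpha : 0 < alpha)
    (hmu0 : Num.max (gamma / alpha) 0 <= mu0)
    (hq : 0 <= q) (hp : 0 <= p) :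
  ((forall mu x : R, mu0 < mu -> 0 < x ->
      F / (q + x) `^ mu <= Stilde x a gamma alpha mu
      /\ Stilde x a gamma alpha mu <= C / (p + x) `^ mu)
   <->
   (0 <= p <= a `^ alpha
    /\ (Csup p a gamma alpha <= C%:E)%E
    /\ (F%:E <= Finf q a gamma alpha)%E))
  /\
  ((0 <= p <= a `^ alpha
    /\ (Csup p a gamma alpha <= C%:E)%E
    /\ (F%:E <= Finf q a gamma alpha)%E) ->
   forall mu : R, mu0 < mu ->
     (forall x : R, 0 < x ->
        F / (q + x) `^ mu < Stilde x a gamma alpha mu
        /\ Stilde x a gamma alpha mu < C / (p + x) `^ mu)
     /\
     (0 < q -> 0 < p ->
        F / (q + 0) `^ mu < Stilde 0 a gamma alpha mu
        /\ Stilde 0 a gamma alpha mu < C / (p + 0) `^ mu))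
  /\
  (p <= a `^ alpha ->
     (0 < Csup p a gamma alpha)%E /\ (Csup p a gamma alpha < +oo)%E)
  /\
  (a `^ alpha < p -> Csup p a gamma alpha = +oo%E).
Proof.
have max_lt mu : mu0 < mu -> Num.max (gamma / alpha) 0 < mu by exact: le_lt_trans.
(* Stated for [x >= 0] with positive [p + x] and [q + x], to serve both [x > 0] and the endpoint
   [x = 0]. *)
have sufficient : 0 <= p <= a `^ alpha
    /\ (Csup p a gamma alpha <= C%:E)%E /\ (F%:E <= Finf q a gamma alpha)%E ->
    forall mu x, mu0 < mu -> 0 <= x -> 0 < p + x -> 0 < q + x ->
    F / (q + x) `^ mu < Stilde x a gamma alpha mu
    /\ Stilde x a gamma alpha mu < C / (p + x) `^ mu.
  move=> [_ [/Csup_leP fC /Finf_geP Ff]] mu x /max_lt lt_mu x0 px0 qx0.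
  by split; [apply: lt_Stilde|apply: Stilde_lt].
split; [split|split; [|split]].
- move=> H.
  have fb := Stilde_bounds_ftilde R a gamma alpha ha halpha _ _ _ _ _ hq hp H.
  have leC : (Csup p a gamma alpha <= C%:E)%E by apply/Csup_leP => t /fb[].
  split; last by split => //; apply/Finf_geP => t /fb[].
  (* For [p] beyond [a ^ alpha] the supremum is infinite and no real [C] bounds it. *)
  rewrite hp leNgt; apply/negP => /(Csup_pinfty R a gamma alpha ha halpha) Cy.
  by rewrite Cy in leC.
- move=> H mu x lt_mu x0.
  have [] := sufficient H mu x lt_mu (ltW x0) (ltr_wpDl hp x0) (ltr_wpDl hq x0).
  by move=> /ltW ? /ltW.
- move=> H mu lt_mu; split=> [x x0|q0 p0]; last by apply: sufficient; rewrite ?addr0.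
  by apply: sufficient; rewrite ?(ltW x0) ?ltr_wpDl.
- move=> ple; split; first exact: Csup_gt0.
  exact: Csup_lty.
- exact: Csup_pinfty.
Qed.
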